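(* For all rays $a=(a_0,a_1)$, $b=(b_0,b_1)$ and every point $c$ with $\mathrm{Bet}(b_1,b_0,c)$ (so that $\bar b=(b_0,c)$ is a ray opposite to $b$), it is not the case that both $a\sim b$ and $a\sim \bar b$.
   Context: Synthetic plane geometry with classical logic. Primitive notions: points, lines (with equality), incidence $A\in x$, a ternary betweenness relation $\mathrm{Bet}(A,B,C)$ (''$B$ strictly between $A$ and $C$''), lengths with a map $(A,B)\mapsto|AB|$. Points are collinear if some line contains all of them. Axioms: (incidence) there is a point; for every point there is a distinct point; every line has a point; for every line $x$ and $A\in x$ there is $B\in x$, $B\neq A$; for every line there is a point not on it; through two distinct points there is a line; if $A\neq B$, $A,B\in x$ and $x\neq y$ then $A\notin y$ or $B\notin y$. (betweenness) if $\mathrm{Bet}(A,B,C)$ then $A\neq C$, $A,B,C$ collinear, $\mathrm{Bet}(C,B,A)$, and not $\mathrm{Bet}(B,A,C)$. (lengths) $|AB|=|CC|$ iff $A=B$; $|AB|=|BA|$. (line–circle) for $O,A,B$ with $A\neq O$ there is $C$ with ($\mathrm{Bet}(A,O,C)$ or $O=C$) and $|OB|=|OC|$. ''$A,B$ on opposite sides of line $x$'': $A,B\notin x$ and some $O\in x$ has $\mathrm{Bet}(A,O,B)$. (Pasch) if $A,B$ are on opposite sides of $x$ and $C\notin x$, then $A,C$ or $C,B$ are on opposite sides of $x$. Definitions: ''$P,Q$ lie on the same half-line from $O$'', written $\mathrm{SR}(O,P,Q)$, means $O\neq P$, $O\neq Q$, $O,P,Q$ collinear, and not $\mathrm{Bet}(P,O,Q)$.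 A ray is an ordered pair $a=(a_0,a_1)$ of distinct points (origin $a_0$, directing point $a_1$). Rays $a,b$ have the same direction, $a\sim b$, iff $(a_0=b_0\wedge \mathrm{SR}(a_0,a_1,b_1))$ or $(\mathrm{SR}(a_0,a_1,b_0)\wedge \mathrm{Bet}(a_0,b_0,b_1))$ or $(\mathrm{SR}(b_0,b_1,a_0)\wedge\mathrm{Bet}(b_0,a_0,a_1))$. *)

(* Defs.v *)
Set Implicit Arguments.
Unset Strict Implicit.

(** Equality of points, lines and lengths is Leibniz equality. *)
Record primitives := Primitives {
  point : Type;
  line : Type;
  length : Type;
  on : point -> line -> Prop;
  (** [Bet A B C]: B lies strictly between A and C. *)
  Bet : point -> point -> point -> Prop;
  len : point -> point -> length
}.

Arguments on {p} A x.
Arguments Bet {p} A B C.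
Arguments len {p} A B.

Section Predicates.
Variable P : primitives.
Implicit Types (A B C O : point P) (x : line P).

Definition collinear A B C : Prop := exists x, on A x /\ on B x /\ on C x.

Definition opposite_sides x A B : Prop :=
  ~ on A x /\ ~ on B x /\ exists O, on O x /\ Bet A O B.

End Predicates.

Record plane := Plane {
  prims :> primitives;
  point_exists : exists A : point prims, True;
  point_other : forall A : point prims, exists B : point prims, B <> A;
  line_point : forall x : line prims, exists A, on A x;
  line_other_point : forall (x : line prims) (A : point prims),
    on A x -> exists B, on B x /\ B <> A;
  line_point_off : forall x : line prims, exists A, ~ on A x;
  line_through : forall A B : point prims,
    A <> B -> exists x, on A x /\ on B x;
  line_unique : forall (A B : point prims) (x y : line prims),
    A <> B -> on A x -> on B x -> x <> y -> ~ on A y \/ ~ on B y;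
  Bet_neq : forall A B C : point prims, Bet A B C -> A <> C;
  Bet_collinear : forall A B C : point prims, Bet A B C -> collinear A B C;
  Bet_sym : forall A B C : point prims, Bet A B C -> Bet C B A;
  Bet_asym : forall A B C : point prims, Bet A B C -> ~ Bet B A C;
  len_null : forall A B C : point prims, len A B = len C C <-> A = B;
  len_sym : forall A B : point prims, len A B = len B A;
  line_circle : forall O A B : point prims, A <> O ->
    exists C, (Bet A O C \/ O = C) /\ len O B = len O C;
  pasch : forall (x : line prims) (A B C : point prims),
    opposite_sides x A B -> ~ on C x ->
    opposite_sides x A C \/ opposite_sides x C B
}.

Section Rays.
Variable G : plane.

(** P and Q lie on the same half-line from O. *)
Definition SR (O P Q : point G) : Prop :=
  O <> P /\ O <> Q /\ collinear O P Q /\ ~ Bet P O Q.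

Record ray := Ray {
  origin : point G;
  director : point G;
  ray_neq : origin <> director
}.

Definition same_direction (a b : ray) : Prop :=
  (origin a = origin b /\ SR (origin a) (director a) (director b))
  \/ (SR (origin a) (director a) (origin b)
      /\ Bet (origin a) (origin b) (director b))
  \/ (SR (origin b) (director b) (origin a)
      /\ Bet (origin b) (origin a) (director a)).

Lemma Bet_neq23 (A B C : point G) : Bet A B C -> B <> C.
Proof.
intros h e; subst C; apply Bet_sym in h; exact (Bet_asym h h).
Qed.

(** The ray (b0, c), for b = (b0, b1) and c such that Bet b1 b0 c. *)
Definition opposite_ray (b : ray) (c : point G)
    (h : Bet (director b) (origin b) c) : ray :=
  Ray (Bet_neq23 h).

End Rays.

(* Main.v *)
(** Every combination of cases in the two relations either contradicts itself at
    once or contradicts one of two facts about points of a single line: if O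
    separates A from B, it separates any third point C from A or from B (Pasch,
    for a transversal through O); and O cannot separate all three pairs among
    A, B, C. For the latter, one of A, B, C lies between the other two, say B,
    and the first fact at B, with O as third point, contradicts asymmetry. That
    one of three collinear points lies between the other two is Wald's proof of
    Hilbert's Theorem 4, which needs only Pasch and the extension of segments. *)
From Stdlib Require Import Classical.
Require Import Defs.

Set Implicit Arguments.
Unset Strict Implicit.

Section Order.
Variable G : plane.
Implicit Types (A B C D E O P Q : point G) (x y m l p q : line G).

Lemma meet_unique A B x y :
  x <> y -> on A x -> on B x -> on A y -> on B y -> A = B.
Proof.
intros nxy Ax Bx Ay By; apply NNPP; intro nAB.
destruct (line_unique nAB Ax Bx nxy); contradiction.
Qed.

Lemma line_eq A B x y :
  A <> B -> on A x -> on B x -> on A y -> on B y -> x = y.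
Proof.
intros nAB Ax Bx Ay By; apply NNPP; intro nxy.
exact (nAB (meet_unique nxy Ax Bx Ay By)).
Qed.

Lemma Bet_neq12 A B C : Bet A B C -> A <> B.
Proof. intros h e; exact (Bet_neq23 (Bet_sym h) (eq_sym e)). Qed.

Lemma Bet_asym_r A B C : Bet A B C -> ~ Bet A C B.
Proof. intros h k; exact (Bet_asym (Bet_sym h) (Bet_sym k)). Qed.

Lemma Bet_on_mid A B C x : Bet A B C -> on A x -> on C x -> on B x.
Proof.
intros h Ax Cx; destruct (Bet_collinear h) as [y [Ay [By Cy]]].
now rewrite (line_eq (Bet_neq h) Ax Cx Ay Cy).
Qed.

Lemma Bet_on_end A B C x : Bet A B C -> on A x -> on B x -> on C x.
Proof.
intros h Ax Bx; destruct (Bet_collinear h) as [y [Ay [By Cy]]].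
now rewrite (line_eq (Bet_neq12 h) Ax Bx Ay By).
Qed.

(** The circle about [O] is taken through [A] itself: the degenerate answer [O = C] would give the
    segment from [O] to [A] null length. *)
Lemma extend A O : A <> O -> exists C, Bet A O C.
Proof.
intro nAO; destruct (line_circle A nAO) as [C [[h | e] hl]].
- now exists C.
- subst C; apply len_null in hl; congruence.
Qed.

(** Locates the crossing whose existence Pasch asserts: [A] shows that [x] and [m] differ, so they
    meet only once, at the known point [O]. *)
Lemma opposite_sides_Bet x m A B O :
  opposite_sides x A B -> on A m -> on B m -> on O x -> on O m -> Bet A O B.
Proof.
intros [nA [_ [O' [O'x h]]]] Am Bm Ox Om.
assert (nxm : x <> m) by congruence.
now rewrite (meet_unique nxm Ox O'x Om (Bet_on_mid h Am Bm)).
Qed.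

Lemma Bet_separates A B C O m :
  Bet A O B -> on A m -> on B m -> on C m -> C <> O -> Bet A O C \/ Bet C O B.
Proof.
intros h Am Bm Cm nCO.
assert (Om := Bet_on_mid h Am Bm).
destruct (line_point_off m) as [D Dm].
assert (nOD : O <> D) by congruence.
destruct (line_through nOD) as [x [Ox Dx]].
assert (off : forall X, on X m -> X <> O -> ~ on X x).
{ intros X Xm nX Xx; apply Dm; now rewrite (line_eq nX Xm Om Xx Ox). }
assert (o : opposite_sides x A B).
{ split; [|split].
  - exact (off _ Am (Bet_neq12 h)).
  - exact (off _ Bm (fun e => Bet_neq23 h (eq_sym e))).
  - now exists O. }
destruct (pasch o (off _ Cm nCO)) as [k | k]; [left | right];
  apply (opposite_sides_Bet k (m := m)); assumption.
Qed.

(** Pasch for [p], which separates [B] from [E] at [D], with third point [C]: [p] could separate [B]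
    from [C] only at [A]. *)
Lemma pasch_vertex A B C D E m p :
  A <> B -> A <> C -> on A m -> on B m -> on C m -> ~ on D m ->
  on A p -> on D p -> Bet B D E -> ~ Bet B A C -> opposite_sides p C E.
Proof.
intros nAB nAC Am Bm Cm Dm Ap Dp h nBAC.
assert (Bp : ~ on B p).
{ intro Bp; apply Dm; now rewrite (line_eq nAB Am Bm Ap Bp). }
assert (Cp : ~ on C p).
{ intro Cp; apply Dm; now rewrite (line_eq nAC Am Cm Ap Cp). }
assert (Ep : ~ on E p).
{ intro Ep; exact (Bp (Bet_on_end (Bet_sym h) Ep Dp)). }
assert (o : opposite_sides p B E) by (repeat split; trivial; now exists D).
destruct (pasch o Cp) as [k | k]; trivial.
destruct nBAC; exact (opposite_sides_Bet k Bm Cm Ap Am).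
Qed.

Lemma Bet_total A B C m :
  A <> B -> B <> C -> A <> C -> on A m -> on B m -> on C m ->
  Bet B A C \/ Bet A B C \/ Bet A C B.
Proof.
intros nAB nBC nAC Am Bm Cm.
destruct (classic (Bet B A C)) as [|nA]; [now left | right].
destruct (classic (Bet A C B)) as [|nC]; [now right | left].
destruct (line_point_off m) as [D Dm].
assert (nAD : A <> D) by congruence.
assert (nBD : B <> D) by congruence.
assert (nCD : C <> D) by congruence.
destruct (extend nBD) as [H BDH].
destruct (line_through nAD) as [p [Ap Dp]].
destruct (line_through nCD) as [q [Cq Dq]].
destruct (line_through nBD) as [l [Bl Dl]].
assert (Hl := Bet_on_end BDH Bl Dl).
assert (oCH : opposite_sides p C H)
  by exact (pasch_vertex nAB nAC Am Bm Cm Dm Ap Dp BDH nA).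
assert (oAH : opposite_sides q A H).
{ refine (pasch_vertex _ _ Cm Bm Am Dm Cq Dq BDH _); auto.
  intro k; exact (nC (Bet_sym k)). }
destruct oCH as [Cp [Hp [E [Ep CEH]]]].
destruct (Bet_collinear CEH) as [r [Cr [Er Hr]]].
assert (Al : ~ on A l).
{ intro Al; apply Dm; now rewrite (line_eq nAB Am Bm Al Bl). }
assert (Cl : ~ on C l).
{ intro Cl; apply Dm; now rewrite (line_eq nBC Bm Cm Bl Cl). }
assert (nED : E <> D).
{ intros ->; exact (Cl (Bet_on_end (Bet_sym CEH) Hl Dl)). }
assert (Eq : ~ on E q).
{ intro Eq; apply Cp; now rewrite (line_eq nED Ep Dp Eq Dq). }
assert (El : ~ on E l).
{ intro El; apply Al; now rewrite <- (line_eq nED Ep Dp El Dl). }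
(* [q] separates [A] from [H]. It meets the line of [E] and [H] at [C], outside their segment, so it
   must separate [A] from [E], and does so at [D]. *)
assert (ADE : Bet A D E).
{ destruct (pasch oAH Eq) as [k | k].
  - exact (opposite_sides_Bet k Ap Ep Dq Dp).
  - destruct (Bet_asym CEH (opposite_sides_Bet k Er Hr Cq Cr)). }
assert (oAE : opposite_sides l A E) by (repeat split; trivial; now exists D).
(* Likewise [l] meets the line of [C] and [E] at [H], outside their segment, so it crosses between
   [A] and [C], at [B]. *)
destruct (pasch oAE Cl) as [k | k].
- exact (opposite_sides_Bet k Am Cm Bl Bm).
- destruct (Bet_asym_r CEH (opposite_sides_Bet k Cr Er Hl Hr)).
Qed.

Lemma Bet_mid_not_separated A B C O :
  Bet A O B -> Bet B O C -> ~ Bet A B C.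
Proof.
intros hAB hBC h; destruct (Bet_collinear h) as [m [Am [Bm Cm]]].
assert (Om := Bet_on_mid hAB Am Bm).
destruct (Bet_separates h Am Cm Om (Bet_neq23 hAB)) as [k | k].
- exact (Bet_asym_r hAB k).
- exact (Bet_asym hBC k).
Qed.

Lemma not_all_separated A B C O :
  Bet A O B -> Bet B O C -> ~ Bet A O C.
Proof.
intros hAB hBC hAC.
destruct (Bet_collinear hAB) as [m [Am [Om Bm]]].
assert (Cm := Bet_on_end hBC Bm Om).
destruct (Bet_total (Bet_neq hAB) (Bet_neq hBC) (Bet_neq hAC) Am Bm Cm)
  as [k | [k | k]].
- exact (Bet_mid_not_separated (Bet_sym hAB) hAC k).
- exact (Bet_mid_not_separated hAB hBC k).
- exact (Bet_mid_not_separated hAC (Bet_sym hBC) k).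
Qed.

(** [O] would separate [P] from [A] or from [B], which one of the half-lines excludes. *)
Lemma SR_not_both_sides O P A B : Bet A O B -> SR O P A -> ~ SR O P B.
Proof.
intros h [nP [_ [[m [Om [Pm Am]]] nA]]] [_ [_ [_ nB]]].
assert (Bm := Bet_on_end h Am Om).
destruct (Bet_separates h Am Bm Pm (fun e => nP (eq_sym e))) as [k | k].
- exact (nA (Bet_sym k)).
- exact (nB k).
Qed.

Lemma SR_sym O P Q : SR O P Q -> SR O Q P.
Proof.
intros [nP [nQ [[m [Om [Pm Qm]]] h]]]; repeat split; trivial.
- now exists m.
- intro k; exact (h (Bet_sym k)).
Qed.

End Order.

Theorem theorem9 :
  forall (G : plane) (a b : ray G) (c : point G)
    (h : Bet (director b) (origin b) c),
    ~ (same_direction a b /\ same_direction a (opposite_ray h)).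
Proof.
intros G [a0 a1 na] [b0 b1 nb] c h; unfold same_direction; simpl in *.
(* Only the three cases using the same clause twice need [h]; in the others, the origins are both
   equal and distinct, or [a0] both does and does not separate [a1] from [b0]. *)
intros [[[e s] | [[s t] | [s t]]] [[e' s'] | [[s' t'] | [s' t']]]].
- subst b0; exact (SR_not_both_sides h s s').
- destruct s' as [_ [n _]]; exact (n e).
- destruct s' as [_ [n _]]; exact (n (eq_sym e)).
- destruct s as [_ [n _]]; exact (n e').
- exact (not_all_separated t h t').
- destruct s as [_ [_ [_ n]]]; exact (n (Bet_sym t')).
- destruct s as [_ [n _]]; exact (n (eq_sym e')).
- destruct s' as [_ [_ [_ n]]]; exact (n (Bet_sym t)).
- exact (SR_not_both_sides h (SR_sym s) (SR_sym s')).
Qed.
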